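(* For every integer $k\ge1$ there is a $(2k+2)\,CS\to k\,CS$ distillation protocol at distance $2$, given by the following matrix. Let $G\in\mathbb F_4^{(k+1)\times(2k+2)}$ have columns grouped into $k+1$ consecutive blocks of two columns (blocks $0,1,\dots,k$). For $1\le j\le k$, row $j$ (a logical row) equals $(0,1)$ on block $0$, $(1,1)$ on blocks $1,\dots,j-1$, $(\omega,\omega^2)$ on block $j$, and $(0,0)$ on blocks $j+1,\dots,k$. The last row $k+1$ (the stabilizer row) is the all-ones vector: $$G=\left(\begin{array}{cccccc}0\;1&\omega\;\omega^2&0\;0&0\;0&\cdots&0\;0\\0\;1&1\;1&\omega\;\omega^2&0\;0&\cdots&0\;0\\ \vdots&\vdots&\vdots&\vdots&\ddots&\vdots\\0\;1&1\;1&1\;1&1\;1&\cdots&\omega\;\omega^2\\\hline1\;1&1\;1&1\;1&1\;1&\cdots&1\;1\end{array}\right).$$ Then $G$ has full rank and, with $k$ logical rows, $$\sum_{i}g_{a,i}g_{b,i}g_{c,i}=\begin{cases}1&1\le a=b=c\le k\\0&\text{otherwise}\end{cases}\qquad(1\le a,b,c\le k+1);$$ consequently $D_G=C\,(CS^{\otimes k}\otimes I)$ for some diagonal Clifford unitary $C$; and the $Z$-distance of the corresponding CSS code is $2$.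
   Context: $\mathbb F_4=\{0,1,\omega,\omega^2\}$, $\omega^2=\omega+1$. Writing $\gamma=b_1\omega+b_2\omega^2$ ($b_1,b_2\in\{0,1\}$) identifies an $\mathbb F_4$-qudit with two qubits, and $CS|\gamma\rangle=i^{b_1b_2}|\gamma\rangle$; put $c(\gamma)=b_1b_2$. A full-rank matrix $G\in\mathbb F_4^{m\times n}$ with $k$ logical rows defines a CSS code on $n$ $\mathbb F_4$-qudits: the first $k$ rows are $X$-logical operators, the last $m-k$ rows are $X$-stabilizer generators. Its $Z$-distance is the minimum Hamming weight (number of nonzero $\mathbb F_4$-coordinates) of a vector in $\mathbb F_4^n$ orthogonal (for $\sum x_iy_i$) to all of the last $m-k$ rows but not to at least one of the first $k$ rows. The unitary on $m$ qudits induced by applying $CS$ to each of the $n$ physical qudits is $D_G|u\rangle=i^{\sum_{i=1}^n c(\sum_a u_ag_{a,i})}|u\rangle$, $u\in\mathbb F_4^m$ (inner sum in $\mathbb F_4$, outer sum over integers). An ''$n\,CS\to k\,CS$ protocol at distance $d$'' means such a matrix with $D_G=C(CS^{\otimes k}\otimes I)$ for a diagonal Clifford $C$ on the $2m$ qubits ($CS^{\otimes k}$ acting on the first $k$ qudits) and with $Z$-distance $d$. *)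

(* Defs.v *)
From mathcomp Require Import all_boot all_order all_algebra.

Set Implicit Arguments.
Unset Strict Implicit.
Unset Printing Implicit Defensive.

Import Order.TTheory GRing.Theory Num.Theory.
Local Open Scope ring_scope.
Local Open Scope sesquilinear_scope.

(** F_4 is any field F of cardinality 4 with a chosen w such that w^2 = w + 1.
    The complex numbers are any C : numClosedFieldType. *)

Definition of_bits (F : finFieldType) (w : F) (b : bool * bool) : F :=
  b.1%:R * w + b.2%:R * w ^+ 2.

(* The default value is never used when w ^+ 2 = w + 1 and #|F| = 4,
   see bitsK below. *)
Definition bits (F : finFieldType) (w : F) (x : F) : bool * bool :=
  odflt (false, false) [pick b : bool * bool | of_bits w b == x].

Lemma of_bits_inj (F : finFieldType) (w : F) :
  w ^+ 2 = w + 1 -> injective (of_bits w).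
Proof.
move=> w2.
have w0 : w != 0.
  apply/eqP => z; move: w2; rewrite z expr0n /= add0r => /eqP.
  by rewrite eq_sym oner_eq0.
have w20 : w ^+ 2 != 0 by rewrite expf_neq0.
have ww2 : w != w ^+ 2 by rewrite w2 eq_sym -subr_eq0 [w + 1]addrC addrK oner_eq0.
have s0 : w + w ^+ 2 != 0.
  by rewrite expr2 -{1}[w]mulr1 -mulrDr addrC -w2 mulf_neq0.
have s1 : w + w ^+ 2 != w by rewrite -subr_eq0 addrC addKr.
have s2 : w + w ^+ 2 != w ^+ 2 by rewrite -subr_eq0 addrK.
by move=> [[] []] [[] []]; rewrite /of_bits /= ?mul1r ?mul0r ?addr0 ?add0r //;
   move/eqP; rewrite 1?(negPf w0) 1?(negPf w20) 1?(negPf ww2) 1?(negPf s0)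
     1?(negPf s1) 1?(negPf s2) // eq_sym
     1?(negPf w0) 1?(negPf w20) 1?(negPf ww2) 1?(negPf s0)
     1?(negPf s1) 1?(negPf s2).
Qed.

Lemma bitsK (F : finFieldType) (w : F) :
  #|F| = 4 -> w ^+ 2 = w + 1 -> cancel (bits w) (of_bits w).
Proof.
move=> cF w2 x; rewrite /bits; case: pickP => [b /eqP //|nob].
have /codomP [b xb] : x \in codom (of_bits w).
  by rewrite (inj_card_onto (of_bits_inj w2)) // cF card_prod card_bool.
by move: (nob b); rewrite xb eqxx.
Qed.

Definition cfun (F : finFieldType) (w : F) (x : F) : nat :=
  ((bits w x).1 * (bits w x).2)%N.

(* Operators on the space with orthonormal basis (|x>)_(x : B) are matrices
   indexed through enum_rank : B -> 'I_#|B|. *)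

(* The entry of index (x, y) is <x| U |y>. *)
Definition op_of (C : numClosedFieldType) (B : finType) (f : B -> B -> C) :
  'M[C]_#|B| := \matrix_(i, j) f (enum_val i) (enum_val j).

Definition entry (C : numClosedFieldType) (B : finType) (U : 'M[C]_#|B|)
  (x y : B) : C := U (enum_rank x) (enum_rank y).

Definition diag_op (C : numClosedFieldType) (B : finType) (f : B -> C) :
  'M[C]_#|B| := op_of (fun x y => (x == y)%:R * f x).

(* The tensor product of one operator on C^A at each position p : P. *)
Definition tensor (C : numClosedFieldType) (P A : finType)
  (U : P -> 'M[C]_#|A|) : 'M[C]_#|{ffun P -> A}| :=
  op_of (fun x y : {ffun P -> A} => \prod_p entry (U p) (x p) (y p)).

(* X^a Z^b on one qubit: |y> is mapped to (-1)^(b y) |y + a>. *)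
Definition pauli1 (C : numClosedFieldType) (a b : bool) : 'M[C]_#|{: bool}| :=
  op_of (fun x y => (x == y (+) a)%:R * (-1) ^+ (b && y)).

Definition is_pauli (C : numClosedFieldType) (Q : finType)
  (U : 'M[C]_#|{ffun Q -> bool}|) : Prop :=
  exists (t : nat) (a b : {ffun Q -> bool}),
    U = 'i ^+ t *: tensor (fun q => pauli1 C (a q) (b q)).

Definition is_clifford (C : numClosedFieldType) (Q : finType)
  (U : 'M[C]_#|{ffun Q -> bool}|) : Prop :=
  U \is unitarymx /\ forall P, is_pauli P -> is_pauli (U *m P *m U ^t*).

(* Qubits (a, false) and (a, true) carry the bits b1 and b2 of qudit a. *)
Definition qudits_of_qubits (F : finFieldType) (w : F) (m : nat)
  (x : {ffun 'I_m * bool -> bool}) : {ffun 'I_m -> F} :=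
  [ffun a => of_bits w (x (a, false), x (a, true))].

Definition qubit_op (C : numClosedFieldType) (F : finFieldType) (w : F)
  (m : nat) (U : 'M[C]_#|{ffun 'I_m -> F}|) :
  'M[C]_#|{ffun 'I_m * bool -> bool}| :=
  op_of (fun x y => entry U (qudits_of_qubits w x) (qudits_of_qubits w y)).

Definition diagonal_clifford (C : numClosedFieldType) (F : finFieldType)
  (w : F) (m : nat) (U : 'M[C]_#|{ffun 'I_m -> F}|) : Prop :=
  is_diag_mx U /\ is_clifford (qubit_op w U).

Definition CS (C : numClosedFieldType) (F : finFieldType) (w : F) :
  'M[C]_#|F| := diag_op (fun x => 'i ^+ cfun w x).

(* CS on each of the first k qudits, the identity on the other m - k. *)
Definition CSk (C : numClosedFieldType) (F : finFieldType) (w : F)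
  (m k : nat) : 'M[C]_#|{ffun 'I_m -> F}| :=
  tensor (fun a : 'I_m => if (a < k)%N then CS C w else 1%:M).

Definition D (C : numClosedFieldType) (F : finFieldType) (w : F)
  (m n : nat) (G : 'M[F]_(m, n)) : 'M[C]_#|{ffun 'I_m -> F}| :=
  diag_op (fun u : {ffun 'I_m -> F} =>
    'i ^+ (\sum_(i < n) cfun w (\sum_(a < m) u a * G a i)%R)%N).

(* Rows of index < k are logical, the others are X-stabilizer generators. *)

Definition weight (F : finFieldType) (n : nat) (v : 'rV[F]_n) : nat :=
  #|[set i | v 0 i != 0]|.

Definition orthogonal_row (F : finFieldType) (m n : nat) (G : 'M[F]_(m, n))
  (v : 'rV[F]_n) (a : 'I_m) : Prop := \sum_(i < n) v 0 i * G a i = 0.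

Definition z_logical (F : finFieldType) (m n : nat) (k : nat)
  (G : 'M[F]_(m, n)) (v : 'rV[F]_n) : Prop :=
  (forall a : 'I_m, (k <= a)%N -> orthogonal_row G v a) /\
  (exists a : 'I_m, (a < k)%N /\ ~ orthogonal_row G v a).

Definition z_distance_is (F : finFieldType) (m n : nat) (k : nat)
  (G : 'M[F]_(m, n)) (d : nat) : Prop :=
  (exists v, z_logical k G v /\ weight v = d) /\
  (forall v, z_logical k G v -> (d <= weight v)%N).

Definition CS_protocol (C : numClosedFieldType) (F : finFieldType) (w : F)
  (m n k d : nat) (G : 'M[F]_(m, n)) : Prop :=
  [/\ (k <= m)%N, row_free G,
      exists U : 'M[C]_#|{ffun 'I_m -> F}|,
        diagonal_clifford w U /\ D C w G = U *m CSk C w m k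
    & z_distance_is k G d].

(* Rows are numbered from 1 by j = a + 1; column i is column i mod 2 of
   block i / 2. *)
Definition Gmat (F : finFieldType) (w : F) (k : nat) :
  'M[F]_(k + 1, 2 * k + 2) :=
  \matrix_(a, i)
    let j := a.+1 in let b := (i %/ 2)%N in let second := odd i in
    if (j == k + 1)%N then 1
    else if (b == 0)%N then (if second then 1 else 0)
    else if (b < j)%N then 1
    else if (b == j)%N then (if second then w ^+ 2 else w)
    else 0.

(* Main.v *)
Require Import Defs.
From mathcomp Require Import all_boot all_order all_algebra.
From mathcomp Require Import ring.
From mathcomp Require Import finfield.
Import GRing.Theory Num.Theory.
Local Open Scope ring_scope.
Local Open Scope sesquilinear_scope.

(** The third difference of the phase i^c(x) on F_4 is the sign
    (-1)^tr(x y z).  Hence the third difference of the phase of D_G is the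
    sign of the trace of the trilinear form with coefficients
    sum_i g_(a,i) g_(b,i) g_(c,i).  When this form is the one of CS on the
    first k qudits, the phase of D_G (CS^k)^-1 has trivial third differences.
    Its second differences are then characters of the qubit group, so it maps
    every Pauli operator to a Pauli operator.  Pairing a linear relation
    between the rows of G with g_b^2 kills its coefficient at each logical row
    b, which gives the full rank.  Orthogonality to the all-ones row excludes
    Z-logical operators of weight one. *)

(** * Entries of operators; diagonal operators *)

Lemma entry_op_of (C : numClosedFieldType) (B : finType) (f : B -> B -> C) x y :
  entry (op_of f) x y = f x y.
Proof. by rewrite /entry mxE !enum_rankK. Qed.

Lemma entry_inj (C : numClosedFieldType) (B : finType) (U V : 'M[C]_#|B|) :
  (forall x y, entry U x y = entry V x y) -> U = V.
Proof.
move=> UV; apply/matrixP => i j.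
by have := UV (enum_val i) (enum_val j); rewrite /entry !enum_valK.
Qed.

Lemma entry_mulmx (C : numClosedFieldType) (B : finType) (U V : 'M[C]_#|B|) x y :
  entry (U *m V) x y = \sum_z entry U x z * entry V z y.
Proof.
rewrite /entry mxE (reindex enum_rank) //=.
by exists enum_val => z _; rewrite ?enum_rankK ?enum_valK.
Qed.

Lemma entry_scalar (C : numClosedFieldType) (B : finType) (c : C) (x y : B) :
  entry c%:M x y = (x == y)%:R * c.
Proof. by rewrite /entry mxE (inj_eq enum_rank_inj) mulr_natl. Qed.

Lemma entry_scale (C : numClosedFieldType) (B : finType) (c : C)
  (U : 'M[C]_#|B|) x y : entry (c *: U) x y = c * entry U x y.
Proof. by rewrite /entry mxE. Qed.

Lemma entry_diag (C : numClosedFieldType) (B : finType) (f : B -> C) x y :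
  entry (diag_op f) x y = (x == y)%:R * f x.
Proof. exact: entry_op_of. Qed.

Lemma entry_diag_mul (C : numClosedFieldType) (B : finType) (f : B -> C)
  (U : 'M[C]_#|B|) x y : entry (diag_op f *m U) x y = f x * entry U x y.
Proof.
rewrite entry_mulmx (bigD1 x) //= big1 ?addr0 => [|z zx];
  by rewrite entry_diag ?eqxx ?mul1r // eq_sym (negPf zx) !mul0r.
Qed.

Lemma entry_mul_diag (C : numClosedFieldType) (B : finType) (f : B -> C)
  (U : 'M[C]_#|B|) x y : entry (U *m diag_op f) x y = entry U x y * f y.
Proof.
rewrite entry_mulmx (bigD1 y) //= big1 ?addr0 => [|z zy];
  by rewrite entry_diag ?eqxx ?mul1r // (negPf zy) mul0r mulr0.
Qed.

Lemma diag_op_mul (C : numClosedFieldType) (B : finType) (f g : B -> C) :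
  diag_op f *m diag_op g = diag_op (fun x => f x * g x).
Proof.
by apply: entry_inj => x y; rewrite entry_diag_mul !entry_diag mulrCA.
Qed.

Lemma eq_diag_op (C : numClosedFieldType) (B : finType) (f g : B -> C) :
  f =1 g -> diag_op f = diag_op g.
Proof. by move=> fg; apply: entry_inj => x y; rewrite !entry_diag fg. Qed.

Lemma diag_op1 (C : numClosedFieldType) (B : finType) :
  diag_op (fun _ : B => 1) = 1%:M :> 'M[C]__.
Proof. by apply: entry_inj => x y; rewrite entry_diag entry_scalar. Qed.

Lemma diag_op_adj (C : numClosedFieldType) (B : finType) (f : B -> C) :
  (diag_op f)^t* = diag_op (fun x => (f x)^*).
Proof.
apply: entry_inj => x y; rewrite entry_diag /entry !mxE !enum_rankK eq_sym.
by case: eqP => [->|_]; rewrite ?mul1r ?mul0r ?rmorph0.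
Qed.

Lemma is_diag_diag_op (C : numClosedFieldType) (B : finType) (f : B -> C) :
  is_diag_mx (diag_op f).
Proof.
apply/is_diag_mxP => i j ij; rewrite mxE (inj_eq enum_val_inj).
by rewrite -val_eqE /= (negPf ij) mul0r.
Qed.

Lemma tensor_diag (C : numClosedFieldType) (P A : finType) (f : P -> A -> C) :
  tensor (fun p => diag_op (f p)) =
  diag_op (fun x : {ffun P -> A} => \prod_p f p (x p)).
Proof.
apply: entry_inj => x y; rewrite entry_diag entry_op_of.
under eq_bigr => p _ do rewrite entry_diag.
case: eqP => [<-|/eqP xy].
  by rewrite mul1r; apply: eq_bigr => p _; rewrite eqxx mul1r.
have [p xyp] : exists p, x p != y p.
  apply/existsP; rewrite -negb_forall; apply: contra xy => /forallP xy.
  by apply/eqP/ffunP => p; apply/eqP.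
by rewrite (bigD1 p) //= (negPf xyp) !mul0r.
Qed.

(** * Pauli operators, characters of bit strings and diagonal Cliffords *)

Lemma entry_pauli (C : numClosedFieldType) (Q : finType)
  (a b x y : {ffun Q -> bool}) :
  entry (tensor (fun q => pauli1 C (a q) (b q))) x y =
  (x == y + a)%:R * \prod_q (-1) ^+ (b q && y q).
Proof.
rewrite entry_op_of; under eq_bigr => q _ do rewrite entry_op_of.
case: eqP => [->|/eqP xy].
  by rewrite mul1r; apply: eq_bigr => q _; rewrite ffunE eqxx mul1r.
have [q xyq] : exists q, x q != y q (+) a q.
  apply/existsP; rewrite -negb_forall; apply: contra xy => /forallP xy.
  by apply/eqP/ffunP => q; rewrite ffunE; apply/eqP.
by rewrite (bigD1 q) //= (negPf xyq) !mul0r.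
Qed.

Lemma ffun_bool_addxx (Q : finType) (x : {ffun Q -> bool}) : x + x = 0.
Proof. by apply/ffunP => q; rewrite !ffunE; apply: addbb. Qed.

(** A character is determined by its values on the unit vectors [e q]. Each such value squares to 1,
    since [e q + e q = 0], so it is a sign; [b] marks the positions where this sign is -1. *)
Lemma bool_character (C : numClosedFieldType) (Q : finType)
    (chi : {ffun Q -> bool} -> C) :
  {morph chi : x y / x + y >-> x * y} -> chi 0 = 1 ->
  exists b : {ffun Q -> bool},
    forall x, chi x = \prod_q (-1) ^+ (b q && x q).
Proof.
move=> chiD chi0.
pose e q : {ffun Q -> bool} := [ffun q' => q' == q].
exists [ffun q => chi (e q) != 1] => x.
have -> : x = \sum_q (if x q then e q else 0).
  apply/ffunP => q; rewrite sum_ffunE (bigD1 q) //= big1 => [|q' q'q].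
    by rewrite addr0; case: (x q); rewrite !ffunE ?eqxx.
  by case: (x q'); rewrite !ffunE // eq_sym (negPf q'q).
rewrite (big_morph chi chiD chi0); apply: eq_bigr => q _.
rewrite sum_ffunE (bigD1 q) //= big1 => [|q' q'q]; last first.
  by case: (x q'); rewrite !ffunE // eq_sym (negPf q'q).
rewrite addr0; case: (x q); rewrite !ffunE ?eqxx ?andbF // andbT.
case: eqP => [-> //|/eqP ne1]; rewrite expr1.
have /eqP : chi (e q) ^+ 2 = 1 by rewrite expr2 -chiD ffun_bool_addxx.
by rewrite sqrf_eq1 (negPf ne1) => /eqP.
Qed.

(* The hypothesis [f3] says that the phase exponent of [f] has vanishing third
   differences, so conjugating X^a yields X^a times a character. *)
Lemma clifford_diag (C : numClosedFieldType) (Q : finType)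
    (f : {ffun Q -> bool} -> C)
    (fi : forall x, exists t : nat, f x = 'i ^+ t)
    (f3 : forall x y z, f (x + y + z) * f x * f y * f z =
                        f (x + y) * f (y + z) * f (x + z)) :
  is_clifford (diag_op f).
Proof.
have fV x : (f x)^* = (f x)^-1.
  have [t ->] := fi x.
  by rewrite invC_norm normrX normCi !expr1n invr1 mul1r.
have f_neq0 x : f x != 0.
  by have [t ->] := fi x; rewrite expf_neq0 // neq0Ci.
split.
  apply/unitarymxP; rewrite diag_op_adj diag_op_mul -diag_op1.
  by apply: eq_diag_op => x; rewrite fV divff.
move=> _ [t [a [b ->]]]; have [ta fa] := fi a.
have f0 : f 0 = 1.
  (* At zero the hypothesis reads f(0)^4 = f(0)^3, and f(0) is invertible. *)
  have := f3 0 0 0; rewrite !addr0 -!mulrA => E.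
  by do 3![apply: (mulfI (f_neq0 0))]; rewrite mulr1.
(* The second difference of the phase in the directions [y] and [a]; [f3] with third argument [a]
   makes it multiplicative in [y]. *)
pose chi y := f (y + a) / (f y * f a).
have [||b' chiE] := @bool_character C Q chi.
- move=> x y; rewrite /chi.
  have E : f (x + y + a) =
      f (x + y) * f (y + a) * f (x + a) / (f x * f y * f a).
    by rewrite -f3; field; rewrite !f_neq0.
  by rewrite E; field; rewrite !f_neq0.
- by rewrite /chi add0r f0 mul1r divff.
(* Conjugation multiplies the entry at (y + a, y) by f(y + a) / f(y) = f(a) chi(y). The factor f(a)
   = i^ta goes into the global phase and chi into the Z part. *)
exists (t + ta)%N, a, [ffun q => b' q (+) b q].
apply: entry_inj => x y.
rewrite diag_op_adj entry_mul_diag entry_diag_mul !entry_scale !entry_pauli.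
case: eqP => [->|_]; last by rewrite !mul0r !mulr0 mul0r.
rewrite !mul1r fV exprD -fa.
under [in RHS]eq_bigr => q _ do rewrite ffunE andb_addl signr_addb.
rewrite big_split /= -chiE /chi invfM.
by field; rewrite !f_neq0.
Qed.

(** * Arithmetic of F_4 in bit coordinates and the phase of CS *)

(** The identity x^4 = x at x = -1 gives 1 = -1. *)
Lemma F4_addxx (F : finFieldType) (x : F) : #|F| = 4%N -> x + x = 0.
Proof.
move=> cF; have := expf_card (-1 : F); rewrite cF -signr_odd expr0 => E.
by rewrite -[x + x]mulr2n -mulr_natr mulr2n {1}E addNr mulr0.
Qed.

Lemma F4_expr3 (F : finFieldType) (w : F) :
  #|F| = 4%N -> w ^+ 2 = w + 1 -> w ^+ 3 = 1.
Proof.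
move=> cF w2.
by rewrite exprS w2 mulrDr mulr1 -expr2 w2 addrAC F4_addxx ?add0r.
Qed.

Lemma of_bitsK (F : finFieldType) (w : F) :
  #|F| = 4%N -> w ^+ 2 = w + 1 -> cancel (of_bits w) (bits w).
Proof. by move=> cF w2 b; apply: (of_bits_inj w2); rewrite bitsK. Qed.

Lemma of_bitsD (F : finFieldType) (w : F) (b c : bool * bool) :
  #|F| = 4%N ->
  of_bits w b + of_bits w c = of_bits w (b.1 (+) c.1, b.2 (+) c.2).
Proof.
move=> cF; rewrite /of_bits addrACA -!mulrDl /=.
have addb_nat (x y : bool) : x%:R + y%:R = (x (+) y)%:R :> F.
  by case: x; case: y; rewrite ?addr0 ?add0r //= F4_addxx.
by rewrite !addb_nat.
Qed.

(** The multiplication table of the normal basis (w, w^2): w w = w^2, w^2 w^2 = w, and w w^2 = 1 = w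
    + w^2. *)
Lemma of_bitsM (F : finFieldType) (w : F) (b c : bool * bool) :
  #|F| = 4%N -> w ^+ 2 = w + 1 ->
  of_bits w b * of_bits w c =
  of_bits w (b.1 && c.2 (+) b.2 && c.1 (+) b.2 && c.2,
             b.1 && c.1 (+) b.1 && c.2 (+) b.2 && c.1).
Proof.
move=> cF w2; have w3 := F4_expr3 _ _ cF w2.
have w12 : w + w ^+ 2 = 1 by rewrite w2 addrA F4_addxx ?add0r.
have w21 : w * w ^+ 2 = w + w ^+ 2 by rewrite w12 -(exprS w 2).
have w22 : w ^+ 2 * w ^+ 2 = w by rewrite -exprD (exprD w 3 1) w3 mul1r.
have wI : (w + w ^+ 2) * (w + w ^+ 2) = w + w ^+ 2 by rewrite w12 mulr1.
by case: b => [[] []]; case: c => [[] []];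
   rewrite /of_bits /= ?mul1r ?mul0r ?add0r ?addr0 ?mul0r ?mulr0 ?wI //
     1?w12 ?mulr1 ?mul1r // 1?mulrC ?w21 ?w22.
Qed.

(* The trilinear form on the right is (-1)^tr(x y z): the bits of x in the
   basis (w, w^2) sum to its absolute trace. *)
Lemma phase_third_difference (C : numClosedFieldType) (F : finFieldType) (w : F)
    (x y z : F) (cF : #|F| = 4%N) (w2 : w ^+ 2 = w + 1) :
  let phi u : C := 'i ^+ cfun w u in
  phi (x + y + z) * phi x * phi y * phi z =
  phi (x + y) * phi (y + z) * phi (x + z) *
  (-1) ^+ ((bits w (x * y * z)).1 (+) (bits w (x * y * z)).2).
Proof.
rewrite /= -(bitsK cF w2 x) -(bitsK cF w2 y) -(bitsK cF w2 z).
move: (bits w x) (bits w y) (bits w z) => [a a'] [b b'] [c c'].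
rewrite !of_bitsM // !of_bitsD // /cfun !of_bitsK //=.
(* Writing -1 as i^2 turns both sides into powers of i; their exponents agree modulo 4 for each of
   the 64 bit patterns. *)
rewrite -sqrCi -exprM -!exprD.
have i4 : 'i ^+ 4 = 1 :> C by rewrite (exprM _ 2 2) sqrCi sqrrN expr1n.
by case: a a' b b' c c' => [] [] [] [] [] []; rewrite /= // ?(exprD _ 4) ?i4 //.
Qed.

Lemma trace_signD (C : numClosedFieldType) (F : finFieldType) (w : F)
    (cF : #|F| = 4%N) (w2 : w ^+ 2 = w + 1) :
  {morph (fun x : F => (-1) ^+ ((bits w x).1 (+) (bits w x).2) : C) :
    x y / x + y >-> x * y}.
Proof.
move=> x y.
have -> : bits w (x + y) =
    ((bits w x).1 (+) (bits w y).1, (bits w x).2 (+) (bits w y).2).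
  by rewrite -{1}(bitsK cF w2 x) -{1}(bitsK cF w2 y) of_bitsD // of_bitsK.
by rewrite -signr_addb /= addbACA.
Qed.

(** By trilinearity the left side expands over triples of rows, and [G3] leaves only the terms a = b
    = c < k. *)
Lemma sum_cube (F : comPzRingType) (m n k : nat) (G : 'M[F]_(m, n))
    (G3 : forall a b c : 'I_m, \sum_(i < n) G a i * G b i * G c i =
          if [&& a == b, b == c & (a < k)%N] then 1 else 0)
    (x y z : 'I_m -> F) :
  \sum_(i < n) (\sum_(a < m) x a * G a i) * (\sum_(a < m) y a * G a i) *
               (\sum_(a < m) z a * G a i) =
  \sum_(a < m | (a < k)%N) x a * y a * z a.
Proof.
transitivity (\sum_(i < n) \sum_(a < m) \sum_(b < m) \sum_(c < m)
   x a * y b * z c * (G a i * G b i * G c i)).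
  apply: eq_bigr => i _; rewrite !mulr_suml; apply: eq_bigr => a _.
  rewrite -mulrA mulrCA mulr_suml; apply: eq_bigr => b _.
  by rewrite mulr_sumr mulr_sumr; apply: eq_bigr => c _; ring.
transitivity (\sum_(a < m) \sum_(b < m) \sum_(c < m)
   x a * y b * z c * \sum_(i < n) G a i * G b i * G c i).
  rewrite exchange_big; apply: eq_bigr => a _.
  rewrite exchange_big; apply: eq_bigr => b _.
  rewrite exchange_big; apply: eq_bigr => c _.
  by rewrite mulr_sumr.
rewrite [RHS]big_mkcond; apply: eq_bigr => a _.
rewrite (bigD1 a) //= [X in _ + X]big1 => [|b ba]; last first.
  by apply: big1 => c _; rewrite G3 eq_sym (negPf ba) mulr0.
rewrite (bigD1 a) //= [X in _ + X + _]big1 => [|c ca]; last first.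
  by rewrite G3 eqxx eq_sym (negPf ca) mulr0.
by rewrite G3 !eqxx /=; case: ifP; rewrite ?mulr1 ?mulr0 !addr0.
Qed.

(** * From the cubic row sums to the diagonal Clifford *)

Lemma qudits_of_qubits_inj (F : finFieldType) (w : F) (m : nat) :
  w ^+ 2 = w + 1 -> injective (@qudits_of_qubits F w m).
Proof.
move=> w2 x y /ffunP xy; apply/ffunP => [[a s]].
have := xy a; rewrite !ffunE => /(of_bits_inj w2) [e1 e2].
by case: s.
Qed.

(** Additivity lets third differences over qubit strings be computed over F_4. *)
Lemma qudits_of_qubitsD (F : finFieldType) (w : F) (m : nat)
    (x y : {ffun 'I_m * bool -> bool}) : #|F| = 4%N ->
  qudits_of_qubits w (x + y) = qudits_of_qubits w x + qudits_of_qubits w y.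
Proof. by move=> cF; apply/ffunP => a; rewrite !ffunE of_bitsD. Qed.

Lemma qubit_op_diag (C : numClosedFieldType) (F : finFieldType) (w : F)
    (m : nat) (f : {ffun 'I_m -> F} -> C) : w ^+ 2 = w + 1 ->
  qubit_op w (diag_op f) = diag_op (fun x => f (qudits_of_qubits w x)).
Proof.
move=> w2; apply: entry_inj => x y.
by rewrite entry_op_of !entry_diag (inj_eq (qudits_of_qubits_inj _ w _ w2)).
Qed.

Lemma CSk_diag (C : numClosedFieldType) (F : finFieldType) (w : F) (m k : nat) :
  CSk C w m k = diag_op (fun u : {ffun 'I_m -> F} =>
    \prod_(a < m | (a < k)%N) 'i ^+ cfun w (u a)).
Proof.
transitivity (tensor (fun a : 'I_m =>
    diag_op (fun x : F => if (a < k)%N then 'i ^+ cfun w x else 1 : C))).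
  apply: entry_inj => x y; rewrite !entry_op_of; apply: eq_bigr => a _.
  by case: ifP => _ //; rewrite diag_op1.
by rewrite tensor_diag; apply: eq_diag_op => u; rewrite [RHS]big_mkcond.
Qed.

Lemma D_clifford_CSk (C : numClosedFieldType) (F : finFieldType) (w : F)
    (m n k : nat) (G : 'M[F]_(m, n)) (cF : #|F| = 4%N) (w2 : w ^+ 2 = w + 1)
    (G3 : forall a b c : 'I_m, \sum_(i < n) G a i * G b i * G c i =
          if [&& a == b, b == c & (a < k)%N] then 1 else 0) :
  exists U : 'M[C]_#|{ffun 'I_m -> F}|,
    diagonal_clifford w U /\ D C w G = U *m CSk C w m k.
Proof.
pose phi x : C := 'i ^+ cfun w x.
pose sgn x : C := (-1) ^+ ((bits w x).1 (+) (bits w x).2).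
pose L (u : {ffun 'I_m -> F}) i := \sum_(a < m) u a * G a i.
(* [num] and [den] are the phases of D_G and of CS on the first k qudits; the Clifford is their
   quotient. *)
pose num u := \prod_i phi (L u i).
pose den (u : {ffun 'I_m -> F}) := \prod_(a < m | (a < k)%N) phi (u a).
have i4 : 'i ^+ 4 = 1 :> C by rewrite (exprM _ 2 2) sqrCi sqrrN expr1n.
have den0 u : den u != 0.
  by apply/prodf_neq0 => a _; rewrite expf_neq0 // neq0Ci.
have LD u v i : L (u + v) i = L u i + L v i.
  by rewrite -big_split; apply: eq_bigr => a _; rewrite ffunE mulrDl.
have sgn0 : sgn 0 = 1.
  have : sgn 0 * sgn 0 = 1 by rewrite -expr2 sqrr_sign.
  by rewrite -(trace_signD C _ _ cF w2) addr0.
have sgnD : {morph sgn : x y / x + y >-> x * y} := trace_signD C _ _ cF w2.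
have num3 u v x : num (u + v + x) * num u * num v * num x =
    num (u + v) * num (v + x) * num (u + x) * sgn (\sum_i L u i * L v i * L x i).
  rewrite (big_morph sgn sgnD sgn0) -!big_split /=; apply: eq_bigr => i _.
  by rewrite !LD phase_third_difference.
have den3 u v x : den (u + v + x) * den u * den v * den x =
    den (u + v) * den (v + x) * den (u + x) *
    sgn (\sum_(a < m | (a < k)%N) u a * v a * x a).
  rewrite (big_morph sgn sgnD sgn0) -!big_split /=; apply: eq_bigr => a _.
  by rewrite !ffunE phase_third_difference.
have DE : D C w G = diag_op num.
  by apply: eq_diag_op => u; rewrite -prodrXr.
exists (diag_op (fun u => num u / den u)); split; last first.
  rewrite DE CSk_diag diag_op_mul; apply: eq_diag_op => u.
  by rewrite divfK.
split; first exact: is_diag_diag_op.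
rewrite qubit_op_diag //; apply: clifford_diag => [x|x y z].
  move: (qudits_of_qubits w x) => u.
  rewrite /num /den !prodrXr.
  set s := (\sum_(i < n) _)%N; set t := (\sum_(a < m | _) _)%N.
  (* The inverse of i^t is i^(3t), as i^4 = 1. *)
  exists (s + 3 * t)%N; rewrite exprD; congr (_ * _).
  apply: (mulfI (den0 u)); rewrite /den prodrXr -/t divff ?expf_neq0 ?neq0Ci //.
  by rewrite -exprD -mulSn exprM i4 expr1n.
rewrite !qudits_of_qubitsD //.
move: (qudits_of_qubits w x) (qudits_of_qubits w y) (qudits_of_qubits w z).
(* By [sum_cube] numerator and denominator carry the sign of the same trace, so the signs cancel. *)
move=> {}x {}y {}z; rewrite !mulf_div num3 den3 /L (sum_cube _ _ _ _ _ G3).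
by rewrite invfM mulrACA divff ?mulr1 // expf_neq0 // oppr_eq0 oner_eq0.
Qed.

(** * Cubic row sums of the matrix, block by block *)

Lemma sum_pairs (V : nmodType) (n : nat) (f : nat -> V) :
  \sum_(i < 2 * n + 2) f i = \sum_(b < n.+1) (f b.*2 + f b.*2.+1).
Proof.
have -> : (2 * n + 2 = n.+1.*2)%N by rewrite mul2n addn2.
elim: n.+1 => [|m IH]; first by rewrite !big_ord0.
by rewrite doubleS !big_ord_recr /= IH addrA.
Qed.

(* The entry of row j (numbered from 1) in column s of block b. *)
Definition gval {F : finFieldType} (w : F) (k j b : nat) (s : bool) : F :=
  if (j == k + 1)%N then 1
  else if (b == 0)%N then (if s then 1 else 0)
  else if (b < j)%N then 1
  else if (b == j)%N then (if s then w ^+ 2 else w)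
  else 0.

Lemma GmatE (F : finFieldType) (w : F) (k : nat) (a : 'I_(k + 1))
    (i : 'I_(2 * k + 2)) : Gmat w k a i = gval w k a.+1 i./2 (odd i).
Proof. by rewrite mxE /= divn2. Qed.

Lemma Gmat_sum (F : finFieldType) (w : F) (k : nat) (a b c : 'I_(k + 1)) :
  \sum_(i < 2 * k + 2) Gmat w k a i * Gmat w k b i * Gmat w k c i =
  \sum_(t < k.+1)
    (gval w k a.+1 t false * gval w k b.+1 t false * gval w k c.+1 t false +
     gval w k a.+1 t true * gval w k b.+1 t true * gval w k c.+1 t true).
Proof.
pose f i := gval w k a.+1 i./2 (odd i) * gval w k b.+1 i./2 (odd i) *
            gval w k c.+1 i./2 (odd i).
transitivity (\sum_(i < 2 * k + 2) f i).
  by apply: eq_bigr => i _; rewrite !GmatE.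
rewrite sum_pairs; apply: eq_bigr => t _.
by rewrite /f /= uphalf_double doubleK odd_double.
Qed.

(** For p <= k, block 0 contributes 1, and block p contributes 1 unless p = q = r, when it
    contributes 0. All other blocks contribute 0. In characteristic 2 the total is therefore 1
    exactly when the three rows coincide. *)
Lemma gval_sum_sorted (F : finFieldType) (w : F) (k p q r : nat) :
  #|F| = 4%N -> w ^+ 2 = w + 1 ->
  (0 < p)%N -> (p <= q)%N -> (q <= r)%N -> (r <= k + 1)%N ->
  \sum_(t < k.+1)
    (gval w k p t false * gval w k q t false * gval w k r t false +
     gval w k p t true * gval w k q t true * gval w k r t true) =
  if [&& p == q, q == r & (p <= k)%N] then 1 else 0.
Proof.
move=> cF w2 p0 pq qr rk.
have w3 := F4_expr3 _ _ cF w2.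
have w12 : w + w ^+ 2 = 1 by rewrite w2 addrA F4_addxx ?add0r.
(* If p > k, all three rows are the all-ones row and each block gives 1 + 1 = 0. *)
have [pk|kp] := leqP p k; last first.
  rewrite !andbF; apply: big1 => t _.
  have -> : p = (k + 1)%N
    by apply/eqP; rewrite eqn_leq (leq_trans pq) ?(leq_trans qr) // addn1.
  have -> : q = (k + 1)%N
    by apply/eqP; rewrite eqn_leq (leq_trans qr) //= addn1 (leq_trans kp).
  have -> : r = (k + 1)%N
    by apply/eqP; rewrite eqn_leq rk addn1 (leq_trans kp) // (leq_trans pq).
  by rewrite /gval eqxx !mulr1 F4_addxx.
have p1 : (p == k + 1)%N = false by rewrite ltn_eqF // addn1 ltnS.
rewrite andbT big_ord_recl /=.
have -> : gval w k p 0 false = 0 by rewrite /gval p1.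
have g1 j : gval w k j 0 true = 1 by rewrite /gval /=; case: ifP.
rewrite !g1 !mul0r !mulr1 add0r.
(* With block 0 split off, block p has index p - 1 in the remaining sum. *)
have pk' : (p.-1 < k)%N by rewrite prednK.
rewrite (bigD1 (Ordinal pk')) //= big1 ?addr0 => [|t tp]; last first.
  rewrite /bump /= add1n.
  have tp' : (t.+1 == p) = false.
    by apply/negbTE; apply: contra tp => /eqP e; rewrite -val_eqE /= -e.
  (* Before block p all three rows are (1, 1); after it row p vanishes. *)
  have [tltp|ptt] := ltnP t.+1 p.
    have tq := leq_trans tltp pq; have tr := leq_trans tq qr.
    by rewrite /gval /= tltp tq tr !if_same !mulr1 F4_addxx.
  have g0 s : gval w k p t.+1 s = 0.
    by rewrite /gval p1 /= ltnNge ptt /= tp'.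
  by rewrite !g0 !mul0r addr0.
rewrite /bump /= add1n prednK //.
have gp s : gval w k p p s = if s then w ^+ 2 else w.
  by rewrite /gval p1 eqn0Ngt p0 /= ltnn eqxx.
have gj j s : (p < j)%N -> gval w k j p s = 1.
  by move=> pj; rewrite /gval pj eqn0Ngt p0 /= if_same.
(* Block p gives w + w^2 = 1 if p < q, w^2 + w^4 = 1 if p = q < r, and w^3 + w^6 = 0 if p = q =
   r. *)
have [e|pq'] := eqVneq p q; last first.
  have pltq : (p < q)%N by rewrite ltn_neqAle pq' pq.
  by rewrite !gp !gj ?(leq_trans pltq) // !mulr1 w12 F4_addxx.
rewrite -e in qr *; have [<-|pr'] := eqVneq p r; last first.
  have pltr : (p < r)%N by rewrite ltn_neqAle pr' qr.
  rewrite !gp gj // gj // !mulr1 -exprD (exprD w 3 1) w3 mul1r.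
  by rewrite addrC -expr2 [w ^+ 2 + w]addrC w12 F4_addxx.
rewrite !gp -[w * w]/(w ^+ 2) -exprSr -!exprD (exprD w 3 3) w3 mulr1.
by rewrite F4_addxx // addr0.
Qed.

(** Both sides are symmetric in the three rows, so sorting the indices reduces to the previous
    lemma. *)
Lemma Gmat_cube (F : finFieldType) (w : F) (k : nat) (a b c : 'I_(k + 1)) :
  #|F| = 4%N -> w ^+ 2 = w + 1 ->
  \sum_(i < 2 * k + 2) Gmat w k a i * Gmat w k b i * Gmat w k c i =
  if [&& a == b, b == c & (a < k)%N] then 1 else 0.
Proof.
move=> cF w2.
have sorted (a' b' c' : 'I_(k + 1)) : (a' <= b')%N -> (b' <= c')%N ->
    \sum_(i < 2 * k + 2) Gmat w k a' i * Gmat w k b' i * Gmat w k c' i =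
    if [&& a' == b', b' == c' & (a' < k)%N] then 1 else 0.
  move=> ab bc.
  by rewrite Gmat_sum gval_sum_sorted // -[(k + 1)%N]addn1 ?ltn_ord.
wlog ab : a b / (a <= b)%N => [H|].
  have [/H //|/ltnW /H E] := leqP a b.
  under eq_bigr => i _ do rewrite (mulrC (_ a i)).
  rewrite E eq_sym; congr (if _ then _ else _).
  by case: eqP => [->|].
(* It remains to insert c. If c < b the rows are not all equal, and the sorted order is a, c, b or
   c, a, b. *)
have [bc|cb] := leqP b c; first exact: sorted.
have bc : (b == c) = false by rewrite -val_eqE eq_sym ltn_eqF.
under eq_bigr => i _ do rewrite mulrAC.
have [ac|ca] := leqP a c.
  by rewrite (sorted _ _ _ ac (ltnW cb)) [c == b]eq_sym bc /= !andbF.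
under eq_bigr => i _ do rewrite (mulrC (_ a i)).
rewrite (sorted _ _ _ (ltnW ca) ab) bc andbF.
by rewrite -[c == a]val_eqE ltn_eqF.
Qed.

(** * Full rank and Z-distance *)

Lemma Gmat_row_free (F : finFieldType) (w : F) (k : nat) :
  #|F| = 4%N -> w ^+ 2 = w + 1 -> row_free (Gmat w k).
Proof.
move=> cF w2; apply: inj_row_free => v vG.
have vGi i : \sum_a v 0 a * Gmat w k a i = 0.
  by have /rowP /(_ i) := vG; rewrite !mxE.
have v_lt (b : 'I_(k + 1)) : (b < k)%N -> v 0 b = 0.
  move=> bk.
  have : \sum_(a < k + 1) v 0 a *
      \sum_(i < 2 * k + 2) Gmat w k a i * Gmat w k b i * Gmat w k b i = 0.
    under eq_bigr => a _ do rewrite mulr_sumr.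
    rewrite exchange_big big1 // => i _.
    under eq_bigr => a _ do rewrite !mulrA.
    by rewrite -!mulr_suml vGi !mul0r.
  under eq_bigr => a _ do rewrite Gmat_cube //.
  rewrite (bigD1 b) //= big1 => [|a ab]; last by rewrite (negPf ab) mulr0.
  by rewrite !eqxx bk mulr1 addr0.
have le_k (a : 'I_(k + 1)) : (a <= k)%N.
  by have := ltn_ord a; rewrite [X in (_ < X)%N]addn1.
apply/rowP => b; rewrite [RHS]mxE; have [/v_lt //|kb] := ltnP b k.
(* Only the coefficient of the last row is left; column 0, where that row has entry 1, shows that it
   vanishes. *)
have bk : b = k :> nat by apply/eqP; rewrite eqn_leq le_k.
have i0 : (0 < 2 * k + 2)%N by rewrite addn2.
have := vGi (Ordinal i0); rewrite (bigD1 b) //= big1 => [|a ab].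
  by rewrite GmatE /gval bk [X in _ == X]addn1 eqxx mulr1 addr0.
rewrite v_lt ?mul0r // ltn_neqAle le_k andbT.
by apply: contra ab => /eqP ak; rewrite -val_eqE /= ak bk.
Qed.

(** The vector (1, 1) on block 0, zero elsewhere, attains the distance: logical rows are (0, 1)
    there and pair to 1, while the stabilizer row is (1, 1) and pairs to 1 + 1 = 0. *)
Lemma Gmat_z_distance (F : finFieldType) (w : F) (k : nat) :
  #|F| = 4%N -> (0 < k)%N -> z_distance_is k (Gmat w k) 2.
Proof.
move=> cF k0; pose f (i : nat) : F := if (i < 2)%N then 1 else 0.
have dot (a : 'I_(k + 1)) :
    \sum_(i < 2 * k + 2) (\row_i f i) 0 i * Gmat w k a i =
    if (a < k)%N then 1 else 0.
  pose g i := f i * gval w k a.+1 i./2 (odd i).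
  transitivity (\sum_(i < 2 * k + 2) g i).
    by apply: eq_bigr => i _; rewrite GmatE mxE.
  rewrite sum_pairs big_ord_recl big1 => [|t _]; last first.
    by rewrite /g /f /bump /= !mul0r addr0.
  rewrite /g /f /gval /= !mul1r [X in _ == X]addn1 eqSS.
  have := ltn_ord a; rewrite [X in (_ < X)%N]addn1 ltnS leq_eqVlt.
  by case: eqP => [->|_ /= ->]; rewrite addr0 ?ltnn ?F4_addxx ?add0r.
split.
  exists (\row_i f i); split.
    split=> [a ka|]; first by rewrite /orthogonal_row dot ltnNge ka.
    have a0 : (0 < k + 1)%N by rewrite addn1.
    exists (Ordinal a0); split=> //; rewrite /orthogonal_row dot /= k0.
    by apply/eqP; rewrite oner_eq0.
  rewrite /weight -sum1_card big_mkcond /=.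
  transitivity (\sum_(i < 2 * k + 2) (i < 2)%N)%N.
    apply: eq_bigr => i _; rewrite inE mxE /f.
    by case: (i < 2)%N; rewrite ?oner_eq0 ?eqxx.
  by rewrite addn2 !big_ord_recl big1.
move=> v [vst [a [ak nva]]].
have kk : (k < k + 1)%N by rewrite addn1.
(* Row index k is the all-ones stabilizer row. *)
have sv : \sum_i v 0 i = 0.
  rewrite -[RHS](vst (Ordinal kk) (leqnn k)); apply: eq_bigr => i _.
  by rewrite GmatE /gval /= addn1 eqxx mulr1.
rewrite ltnNge leq_eqVlt ltnS leqn0 cards_eq0; apply/negP.
(* In weight one the coordinate sum is the single nonzero entry, contradicting [sv]. In weight zero
   v is orthogonal to every row, contradicting [nva]. *)
case/orP => [/cards1P [i vi]|/eqP v0].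
  have vE j : (v 0 j != 0) = (j == i) by rewrite -(in_set1 j i) -vi inE.
  have := vE i; rewrite eqxx => /eqP; case; rewrite -[RHS]sv (bigD1 i) //=.
  rewrite big1 ?addr0 // => j ji; apply/eqP.
  by have := vE j; rewrite (negPf ji) => /negbFE.
apply: nva; apply: big1 => i _.
have : i \notin [set i | v 0 i != 0] by rewrite v0 inE.
by rewrite inE negbK => /eqP ->; rewrite mul0r.
Qed.

Theorem mainTheorem4 (C : numClosedFieldType) (F : finFieldType) (w : F)
    (k : nat) (hF : #|F| = 4%N) (hw : w ^+ 2 = w + 1) (hk : (1 <= k)%N) :
  let G := Gmat w k in
  [/\ \rank G = (k + 1)%N,
      forall a b c : 'I_(k + 1),
        \sum_(i < 2 * k + 2) G a i * G b i * G c i =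
          if [&& a == b, b == c & (a < k)%N] then 1 else 0
    & CS_protocol C w k 2 G].
Proof.
have G3 a b c := Gmat_cube F w k a b c hF hw.
move=> G; split=> //; first exact/eqP/Gmat_row_free.
split; first exact: leq_addr.
- exact: Gmat_row_free.
- exact: D_clifford_CSk.
- exact: Gmat_z_distance.
Qed.
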